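(* Let $(X,\omega_X,\mu_X)$ and $(Y,\omega_Y,\mu_Y)$ be finite measure networks with $X=\{x_1,\dots,x_n\}$ and $Y=\{y_1,\dots,y_m\}$, where $\omega_X$ and $\omega_Y$ are not assumed symmetric. Let $A_{XY}:\mathbb{R}^{n\times m}\to\mathbb{R}^{n\times m}$ be the linear map $$(A_{XY}C)_{ij}=\sum_{k=1}^n\sum_{l=1}^m |\omega_X(x_i,x_k)-\omega_Y(y_j,y_l)|^2\,C_{kl}.$$ Then the gradient (with respect to the Frobenius inner product) of the map $\mathbb{R}^{n\times m}\to\mathbb{R}$, $C\mapsto\langle A_{XY}C,C\rangle$, at $C$ is $$(A_{XY}+A_{XY}^\ast)\,C,$$ where $A_{XY}^\ast$ denotes the adjoint of $A_{XY}$ with respect to the Frobenius inner product.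
   Context: A finite measure network is a triple $(X,\omega_X,\mu_X)$ where $X$ is a finite set, $\mu_X$ is a probability measure on $X$ with full support, and $\omega_X:X\times X\to\mathbb{R}$ is an arbitrary function. The Frobenius inner product on $\mathbb{R}^{n\times m}$ is $\langle A,B\rangle=\sum_{ij}A_{ij}B_{ij}$. *)

(* Defs.v *)
From HB Require Import structures.
From mathcomp Require Import all_boot all_order all_algebra.
From mathcomp Require Import all_classical all_reals all_analysis.

Set Implicit Arguments.
Unset Strict Implicit.
Unset Printing Implicit Defensive.

Import Order.TTheory GRing.Theory Num.Theory.
Import numFieldNormedType.Exports.

Local Open Scope classical_set_scope.
Local Open Scope ring_scope.

(* A finite set carries its discrete sigma-algebra ([network_discrete]), and a
   measure on it has full support iff every singleton has positive mass. *)
Record finite_measure_network (R : realType) := FiniteMeasureNetwork {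
  network_display : measure_display;
  network_carrier :> measurableType network_display;
  network_finite : finite_set [set: network_carrier];
  network_discrete : forall A : set network_carrier, measurable A;
  omega : network_carrier -> network_carrier -> R;
  network_measure : probability network_carrier R;
  network_full_support : forall x : network_carrier,
    (0 < network_measure [set x])%E }.

Section Frobenius.
Context {R : realType} {n m : nat}.
Implicit Types (A : {linear 'M[R]_(n, m) -> 'M[R]_(n, m)}) (C D G : 'M[R]_(n, m)).

Definition frobenius C D : R := \sum_(i < n) \sum_(j < m) C i j * D i j.

Definition is_adjoint A (B : {linear 'M[R]_(n, m) -> 'M[R]_(n, m)}) : Prop :=
  forall C D, frobenius (A C) D = frobenius C (B D).

(* [get] returns the unique such linear map: see [adjointP], [is_adjoint_uniq]. *)
Definition adjoint A : {linear 'M[R]_(n, m) -> 'M[R]_(n, m)} :=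
  get (is_adjoint A).

(* The topology on matrices is that of the max norm; all norms being equivalent
   here, differentiability does not depend on this choice. *)
Definition is_gradient (f : 'M[R]_(n, m) -> R) C G : Prop :=
  differentiable f C /\ forall H, 'd f C H = frobenius G H.

Lemma frobenius_delta C i j : frobenius C (delta_mx i j) = C i j.
Proof.
rewrite /frobenius (bigD1 i) //= (bigD1 j) //= !mxE !eqxx mulr1.
rewrite big1 => [|l lj]; last by rewrite mxE (negbTE lj) andbF mulr0.
rewrite addr0 big1 ?addr0 // => k ki.
by rewrite big1 // => l _; rewrite mxE (negbTE ki) mulr0.
Qed.

Lemma frobeniusC C D : frobenius C D = frobenius D C.
Proof. by do 2!apply: eq_bigr => ? _; rewrite mulrC. Qed.

Lemma frobenius_is_linear C : linear_for *%R (frobenius C).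
Proof.
move=> a D E; rewrite /frobenius mulr_sumr -big_split; apply: eq_bigr => i _.
rewrite mulr_sumr -big_split; apply: eq_bigr => j _.
by rewrite !mxE mulrDr mulrCA.
Qed.

Lemma frobenius_inj C D : (forall E, frobenius C E = frobenius D E) -> C = D.
Proof.
by move=> CD; apply/matrixP => i j; rewrite -!frobenius_delta CD.
Qed.

Lemma adjointP A : is_adjoint A (adjoint A).
Proof.
pose g D : 'M[R]_(n, m) := \matrix_(i, j) frobenius D (A (delta_mx i j)).
have g_lin : linear g.
  move=> a D E; apply/matrixP => i j; rewrite !mxE.
  by rewrite !(frobeniusC _ (A _)) (@frobenius_is_linear (A (delta_mx i j))).
pose B : {linear 'M[R]_(n, m) -> 'M[R]_(n, m)} :=
  HB.pack g (GRing.isLinear.Build _ _ _ _ g g_lin).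
suff AB : is_adjoint A B by apply: (@getPex _ (is_adjoint A)); exists B.
move=> C D; pose phi : {linear 'M[R]_(n, m) -> R | *%R} := HB.pack (frobenius D)
  (GRing.isLinear.Build _ _ _ _ (frobenius D) (@frobenius_is_linear D)).
rewrite frobeniusC -[frobenius D _]/(phi _) [in LHS](matrix_sum_delta C).
rewrite !linear_sum; apply: eq_bigr => i _.
rewrite !linear_sum; apply: eq_bigr => j _.
by rewrite !linearZ /= mxE.
Qed.

Lemma is_adjoint_uniq A (B B' : {linear 'M[R]_(n, m) -> 'M[R]_(n, m)}) :
  is_adjoint A B -> is_adjoint A B' -> B =1 B'.
Proof.
move=> AB AB' D; apply: frobenius_inj => E.
by rewrite !(frobeniusC _ E) -AB -AB'.
Qed.

Lemma is_gradient_uniq (f : 'M[R]_(n, m) -> R) C G G' :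
  is_gradient f C G -> is_gradient f C G' -> G = G'.
Proof.
by move=> [_ fG] [_ fG']; apply: frobenius_inj => H; rewrite -fG -fG'.
Qed.

End Frobenius.

Section DistortionOperator.
Context {R : realType} {X Y : finite_measure_network R} {n m : nat}.
Variables (x : 'I_n -> X) (y : 'I_m -> Y).

Definition distortion_op (C : 'M[R]_(n, m)) : 'M[R]_(n, m) :=
  \matrix_(i < n, j < m) \sum_(k < n) \sum_(l < m)
    `|omega (x i) (x k) - omega (y j) (y l)| ^+ 2 * C k l.

Lemma distortion_op_is_linear : linear distortion_op.
Proof.
move=> a C D; apply/matrixP => i j; rewrite !mxE mulr_sumr -big_split.
apply: eq_bigr => k _; rewrite mulr_sumr -big_split; apply: eq_bigr => l _.
by rewrite !mxE mulrDr mulrCA.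
Qed.

HB.instance Definition _ := GRing.isLinear.Build R 'M[R]_(n, m) 'M[R]_(n, m)
  *:%R distortion_op distortion_op_is_linear.

End DistortionOperator.

(* Main.v *)
(** Writing [A^*] for the adjoint of [A], the entry [(A D)_ij] is [<A^* e_ij, D>],
    hence linear in [D] with gradient [A^* e_ij].  By the Leibniz rule the gradient
    of [<A D, D>] at [C] is
    [\sum_ij ((A C)_ij e_ij + C_ij A^* e_ij) = A C + A^* C]. *)
From HB Require Import structures.
Require Import Defs.
From mathcomp Require Import all_boot all_order all_algebra.
From mathcomp Require Import all_classical all_reals all_analysis.
Import Order.TTheory GRing.Theory Num.Theory.
Import numFieldNormedType.Exports.
Local Open Scope ring_scope.

Section Gradient.
Context {R : realType} {n m : nat}.
Implicit Types (A : {linear 'M[R]_(n, m) -> 'M[R]_(n, m)}) (C D E G : 'M[R]_(n, m)).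
Implicit Types f g : 'M[R]_(n, m) -> R.

Lemma frobeniusDl C D E : frobenius (C + D) E = frobenius C E + frobenius D E.
Proof.
by rewrite -[C]scale1r !(frobeniusC _ E) frobenius_is_linear mul1r scale1r.
Qed.

Lemma frobenius0l E : frobenius 0 E = 0.
Proof. by apply: (addrI (frobenius 0 E)); rewrite -frobeniusDl !addr0. Qed.

Lemma frobeniusZl (a : R) C E : frobenius (a *: C) E = a * frobenius C E.
Proof.
by rewrite -[a *: C]addr0 !(frobeniusC _ E) frobenius_is_linear
  (frobeniusC _ 0) frobenius0l addr0.
Qed.

(** Gives access to the [is_diff] instances: the sum and product rules below then come from class
    resolution, leaving only an equality of linear forms in the direction [H]. *)
Lemma is_gradient_diff {f C G} :
  is_gradient f C G <-> is_diff C f (frobenius G).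
Proof.
split=> [[df fG]|[df fG]]; split=> //; first by apply/funext => H; rewrite fG.
by move=> H; rewrite fG.
Qed.

Lemma is_gradient_cst (a : R) C : is_gradient (fun=> a) C 0.
Proof.
by split=> [//|H]; rewrite frobenius0l -[fun=> a]/(cst a) diff_cst.
Qed.

Lemma is_gradientD f g C G G' : is_gradient f C G -> is_gradient g C G' ->
  is_gradient (fun D => f D + g D) C (G + G').
Proof.
move=> /is_gradient_diff df /is_gradient_diff dg; apply/is_gradient_diff.
by apply: is_diff_eq; apply/funext => H; rewrite frobeniusDl.
Qed.

Lemma is_gradientM f g C G G' : is_gradient f C G -> is_gradient g C G' ->
  is_gradient (fun D => f D * g D) C (f C *: G' + g C *: G).
Proof.
move=> /is_gradient_diff df /is_gradient_diff dg; apply/is_gradient_diff.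
by apply: is_diff_eq; apply/funext => H; rewrite frobeniusDl !frobeniusZl.
Qed.

Lemma is_gradient_sum (I : Type) (r : seq I) (f : I -> 'M[R]_(n, m) -> R)
    (G : I -> 'M[R]_(n, m)) C : (forall i, is_gradient (f i) C (G i)) ->
  is_gradient (fun D => \sum_(i <- r) f i D) C (\sum_(i <- r) G i).
Proof.
move=> fG; elim: r => [|i r IHr].
  rewrite big_nil; under [X in is_gradient X]eq_fun do rewrite big_nil.
  exact: is_gradient_cst.
rewrite big_cons; under [X in is_gradient X]eq_fun do rewrite big_cons.
exact: is_gradientD.
Qed.

(** A coordinate is linear and continuous, hence its own differential, and pairing with
    [delta_mx i j] reads off that coordinate. *)
Lemma is_gradient_coord i j C : is_gradient (fun D => D i j) C (delta_mx i j).
Proof.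
have coord_lin : linear_for *%R (fun D : 'M[R]_(n, m) => D i j).
  by move=> a D E; rewrite !mxE.
pose coord : {linear 'M[R]_(n, m) -> R | *%R} := HB.pack
  (fun D : 'M[R]_(n, m) => D i j)
  (GRing.isLinear.Build _ _ _ _ (fun D : 'M[R]_(n, m) => D i j) coord_lin).
split=> [|H]; first exact: differentiable_coord.
by rewrite frobeniusC frobenius_delta (diff_lin (f := coord)) //;
  exact: coord_continuous.
Qed.

Lemma is_gradient_frobenius E C : is_gradient (frobenius E) C E.
Proof.
rewrite [X in is_gradient _ _ X](matrix_sum_delta E).
apply: is_gradient_sum => i; apply: is_gradient_sum => j.
(* Each summand is the constant [E i j] times a coordinate. The zero gradient of the constant
   contributes the Leibniz term [C i j *: 0], created here. *)
rewrite -[_ *: _]addr0 -(scaler0 _ (C i j)).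
by apply: is_gradientM; [exact: is_gradient_cst|exact: is_gradient_coord].
Qed.

Lemma is_gradient_quadratic A C :
  is_gradient (fun D => frobenius (A D) D) C (A C + adjoint A C).
Proof.
have entry i j : is_gradient (fun D => A D i j) C (adjoint A (delta_mx i j)).
  under [X in is_gradient X]eq_fun => D
    do rewrite -frobenius_delta adjointP frobeniusC.
  exact: is_gradient_frobenius.
(* Expanding [A C] and the argument of the adjoint in matrix units splits the target into terms [A C
   i j *: delta_mx i j + C i j *: adjoint A (delta_mx i j)], the Leibniz rule for
   [A D i j * D i j]. *)
rewrite (matrix_sum_delta (A C)) [X in adjoint A X](matrix_sum_delta C).
rewrite linear_sum -big_split; apply: is_gradient_sum => i /=.
rewrite linear_sum -big_split; apply: is_gradient_sum => j /=.
by rewrite linearZ; apply: is_gradientM => //; exact: is_gradient_coord.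
Qed.

End Gradient.

Theorem proposition3 (R : realType) (X Y : finite_measure_network R) (n m : nat)
    (x : 'I_n -> X) (y : 'I_m -> Y) (x_bij : bijective x) (y_bij : bijective y)
    (C : 'M[R]_(n, m)) :
  is_gradient (fun D : 'M[R]_(n, m) => frobenius (distortion_op x y D) D) C
    ((distortion_op x y \+ adjoint (distortion_op x y)) C).
(* The quadratic rule applies through the linear structure on [distortion_op x y]; the pointwise sum
   [\+] at [C] unfolds by conversion. *)
Proof. exact: is_gradient_quadratic. Qed.
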